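(* Let $G=\langle x,y\rangle$ be a finite non-cyclic group generated by two elements $x,y$, and let $m\geq 2$ be an integer. Then $G$ admits an O$m$SR of valency $3$, except when $G\cong\mathbb{Z}_2^2$ and $m=2$. That is, $G$ admits an O$m$SR of valency $3$ if and only if it is not the case that both $G\cong\mathbb{Z}_2^2$ and $m=2$.
   Context: A digraph $\Gamma$ is a pair $(V(\Gamma),A(\Gamma))$ with $V(\Gamma)$ a non-empty (here finite) vertex set and $A(\Gamma)\subseteq V(\Gamma)\times V(\Gamma)$ its set of arcs; if $(u,v)\in A(\Gamma)$ then $v$ is an out-neighbor of $u$ and $u$ is an in-neighbor of $v$. The out-valency (in-valency) of a vertex is the number of its out-neighbors (in-neighbors). $\Gamma$ is $k$-regular, or regular of valency $k$, if every vertex has out-valency and in-valency both equal to $k$. $\Gamma$ is oriented if for all vertices $u,v$ at most one of $(u,v)$, $(v,u)$ is an arc when $u\neq v$, and there are no loops (no arc $(u,u)$). An automorphism of $\Gamma$ is a permutation $\sigma$ of $V(\Gamma)$ such that $(u,v)\in A(\Gamma)\iff(u^\sigma,v^\sigma)\in A(\Gamma)$; these form the full automorphism group $\mathrm{Aut}(\Gamma)$. A permutation group acts semiregularly if all its point stabilizers are trivial. For a finite group $G$ and a positive integer $m$, an $m$-Cayley digraph over $G$ is a digraph having a group of automorphisms isomorphic to $G$ that acts semiregularly on the vertex set with exactly $m$ orbits. Equivalently, up to isomorphism, it is the digraph with vertex set $G\times\mathbb{Z}_m$ and arc set $\bigcup_{i,j\in\mathbb{Z}_m}\{((g,i),(tg,j))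 : g\in G,\ t\in T_{i,j}\}$ for some subsets $T_{i,j}\subseteq G$ ($i,j\in\mathbb{Z}_m$); it is oriented exactly when $T_{i,j}\cap T_{j,i}^{-1}=\emptyset$ for all $i,j\in\mathbb{Z}_m$ (including $i=j$). $G$ admits an oriented $m$-semiregular representation (O$m$SR) of valency $k$ if there exists an oriented $k$-regular $m$-Cayley digraph $\Gamma$ over $G$ with $\mathrm{Aut}(\Gamma)\cong G$. *)

(* Defs.v *)
From mathcomp Require Import all_boot all_fingroup all_solvable.

Set Implicit Arguments.
Unset Strict Implicit.
Unset Printing Implicit Defensive.

Import GroupScope.

Record digraph := Digraph {
  vertex :> finType;
  arc : rel vertex;
  vertex_nonempty : 0 < #|vertex|
}.

Section Digraph.

Variable Gamma : digraph.

Definition out_valency (u : Gamma) : nat := #|[set v | arc u v]|.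

Definition in_valency (u : Gamma) : nat := #|[set v | arc v u]|.

Definition regular (k : nat) : Prop :=
  forall u : Gamma, out_valency u = k /\ in_valency u = k.

Definition oriented : Prop :=
  (forall u v : Gamma, u != v -> ~ (arc u v /\ arc v u)) /\
  (forall u : Gamma, ~ arc u u).

Definition digraph_aut : {set {perm Gamma}} :=
  [set s : {perm Gamma} | [forall u, forall v, arc u v == arc (s u) (s v)]].

Lemma digraph_autP (s : {perm Gamma}) :
  reflect (forall u v, arc u v = arc (s u) (s v)) (s \in digraph_aut).
Proof.
rewrite inE; apply: (iffP forallP) => [h u v | h u].
  by have /forallP/(_ v)/eqP := h u.
by apply/forallP => v; rewrite -h.
Qed.

Lemma digraph_aut_group_set : group_set digraph_aut.
Proof.
apply/group_setP; split=> [|s t /digraph_autP hs /digraph_autP ht].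
  by apply/digraph_autP => u v; rewrite !perm1.
by apply/digraph_autP => u v; rewrite !permM hs ht.
Qed.

Canonical digraph_aut_group := Group digraph_aut_group_set.

Definition semiregular_on_vertices (H : {group {perm Gamma}}) : Prop :=
  forall v : Gamma, 'C_H[v | 'P] = 1.

Definition vertex_orbits (H : {group {perm Gamma}}) : {set {set Gamma}} :=
  orbit 'P H @: [set: Gamma].

Definition m_Cayley (gT : finGroupType) (G : {group gT}) (m : nat) : Prop :=
  exists H : {group {perm Gamma}},
    [/\ H \subset digraph_aut, H \isog G, semiregular_on_vertices H
      & #|vertex_orbits H| = m].

End Digraph.

Definition admits_OmSR (gT : finGroupType) (G : {group gT}) (m k : nat) : Prop :=
  exists Gamma : digraph,
    [/\ oriented Gamma, regular Gamma k, m_Cayley Gamma G m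
      & digraph_aut Gamma \isog G].

(* Main.v *)
Require Import Defs.
From mathcomp Require Import all_boot all_fingroup all_solvable all_algebra.
From mathcomp Require Import zify.

Set Implicit Arguments.
Unset Strict Implicit.
Unset Printing Implicit Defensive.

Import GroupScope.

(**
Vertices are pairs (g, i) in G x I, and (g, i) has an arc to (t g, j) for each
(t, j) in a three-element list N i; G acts by right translation.  Such a
digraph is a representation as soon as every automorphism preserves some layer
G x {i0} and every automorphism fixing (1, i0) is trivial.  Layers are told
apart by the arcs inside the out-neighbourhoods of their vertices, and the set
of fixed vertices is then propagated along arcs until it is closed under left
multiplication by both generators.

If x^2 <> 1, take loops (x, i), arcs (1, i+1) and (x, i+1) between successive
layers, and close the cycle of layers by (x^2, 0) and (y, 0): only the last
layer has no transitive triangle.  For two layers this needs x^3 <> 1; if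
x^3 = 1, the arcs leaving the second layer are changed when x and y do not
commute or y^3 = 1, and otherwise y or x y can replace x.
If x, y and x y are all involutions, then G is the Klein group, loops are
impossible, and arcs from layer i to layers i+1 and i+2 are used; with only
two layers all six neighbours of a vertex would lie in the other layer, which
has four elements.
*)

(** * Cancellation identities and closure under two generators *)

Section GroupIdentities.

Variable gT : finGroupType.
Implicit Types (x y z t : gT) (A : {set gT}).

Lemma eq_divg t t' z : (t' * t^-1 == z) = (t' == z * t).
Proof. by rewrite -(inj_eq (mulIg t)) mulgKV. Qed.

Lemma eq_mulgl_id t x : (t == x * t) = (x == 1).
Proof. by rewrite -{1}[t]mul1g (inj_eq (mulIg t)) eq_sym. Qed.

Lemma eq_mulgr_id t x : (t == t * x) = (x == 1).
Proof. by rewrite -{1}[t]mulg1 (inj_eq (mulgI t)) eq_sym. Qed.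

Lemma eq_invg_id x : (x^-1 == x) = (x ^+ 2 == 1).
Proof. by rewrite -(inj_eq (mulgI x)) mulgV eq_sym. Qed.

Lemma expg_neq1 x k : x ^+ k != 1 -> x != 1.
Proof. by apply: contraNneq => ->; rewrite expg1n. Qed.

Lemma neq_notin A z w :
  z \notin A -> w \in A -> ((z == w) = false) * ((w == z) = false).
Proof.
move=> nz Aw; suff e: (z == w) = false by rewrite [w == z]eq_sym e.
by apply: contraNF nz => /eqP->.
Qed.

(** The elements [k] with [k * A] inside [A] are closed under products, hence form a subgroup since
    the group is finite. It contains both generators, so [A] contains every [g * 1]. *)
Lemma left_closed_setT x y A :
    <<[set x; y]>> = [set: gT] -> 1 \in A ->
    (forall g, g \in A -> x * g \in A) -> (forall g, g \in A -> y * g \in A) ->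
  A = [set: gT].
Proof.
move=> gen_xy A1 Ax Ay; pose K := [set k | [forall (g | g \in A), k * g \in A]].
have KP k: reflect (forall g, g \in A -> k * g \in A) (k \in K).
  by rewrite inE; apply: (iffP forall_inP).
have gK: group_set K.
  apply/group_setP; split=> [|k l /KP kA /KP lA]; apply/KP=> g Ag.
    by rewrite mul1g.
  by rewrite -mulgA; apply/kA/lA.
apply/eqP; rewrite eqEsubset subsetT /= -gen_xy.
have sK: <<[set x; y]>> \subset Group gK.
  by rewrite gen_subG; apply/subsetP=> _ /set2P[]->; apply/KP.
apply/subsetP=> g /(subsetP sK)/KP/(_ 1 A1).
by rewrite mulg1.
Qed.

End GroupIdentities.

(** * Automorphisms and out-neighbour lists *)

Section MCayleyDigraph.

Variables (gT : finGroupType) (I : finType) (N : I -> seq (gT * I)).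
Implicit Types (u v w : gT * I) (g t : gT) (i j : I) (s : {perm gT * I}).

(* N i lists the out-neighbours of (1, i). *)
Definition carc : rel (gT * I) := fun u v => (v.1 * u.1^-1, v.2) \in N u.2.

Definition caut s := forall u v, carc (s u) (s v) = carc u v.

Lemma carc1 i v : carc (1, i) v = (v \in N i).
Proof. by case: v => t j; rewrite /carc /= invg1 mulg1. Qed.

Lemma carcM g t j t' j' : carc (t * g, j) (t' * g, j') = carc (t, j) (t', j').
Proof. by rewrite /carc /= invMg mulgA mulgK. Qed.

Lemma carcP g i v :
  reflect (exists2 p, p \in N i & v = (p.1 * g, p.2)) (carc (g, i) v).
Proof.
apply: (iffP idP) => [guv | [[t j] Np ->]].
  by exists (v.1 * g^-1, v.2); rewrite //= mulgKV -surjective_pairing.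
by rewrite -{1}[g]mul1g carcM carc1.
Qed.

Lemma cautV s : caut s -> caut s^-1.
Proof. by move=> s_aut u v; rewrite -s_aut !permKV. Qed.

Definition shift_fun g u := (u.1 * g, u.2).

Lemma shift_fun_inj g : injective (shift_fun g).
Proof. by move=> [t i] [t' i'] [/mulIg-> ->]. Qed.

Definition shift g : {perm gT * I} := perm (@shift_fun_inj g).

Lemma shiftE g t i : shift g (t, i) = (t * g, i).
Proof. by rewrite permE. Qed.

Lemma shift_aut g : caut (shift g).
Proof. by move=> [t i] [t' j]; rewrite !shiftE carcM. Qed.

Lemma shiftM : {in [set: gT] &, {morph shift : g t / g * t}}.
Proof.
by move=> g t _ _; apply/permP=> -[t' i]; rewrite permM !shiftE mulgA.
Qed.

Canonical shift_morphism := Morphism shiftM.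

(** Translations carry [(1, j)] through its whole layer, so an invariant [P] depends on the layer
    alone. This turns a graph property checked at the vertices [(1, j)] into a set of layers
    preserved by all automorphisms. *)
Lemma caut_layer s (Q : pred I) (P : gT * I -> Prop) :
    caut s -> (forall s' u, caut s' -> P u -> P (s' u)) ->
    (forall j, P (1, j) <-> Q j) ->
  forall u, Q (s u).2 = Q u.2.
Proof.
move=> s_aut Paut PQ; have Pu u: P u <-> Q u.2.
  case: u => g j; have -> : (g, j) = shift g (1, j) by rewrite shiftE mul1g.
  split=> [Pg | /= ]; rewrite ?shiftE /=.
    apply/PQ; rewrite -(permK (shift g) (1, j)).
    exact: Paut (cautV (shift_aut g)) Pg.
  by move/PQ/(Paut _ _ (shift_aut g)); rewrite shiftE.
move=> u; apply/idP/idP => /Pu Psu; apply/Pu; last exact: Paut.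
by rewrite -(permK s u); apply/(Paut s^-1)/Psu/cautV.
Qed.

(** Lets the absence of a configuration serve as an invariant in [caut_layer]. *)
Lemma caut_not (P : gT * I -> Prop) :
    (forall s u, caut s -> P u -> P (s u)) ->
  forall s u, caut s -> ~ P u -> ~ P (s u).
Proof.
move=> Paut s u s_aut nPu Psu; apply: nPu; rewrite -(permK s u).
exact: Paut (cautV s_aut) Psu.
Qed.

Definition has_triangle u := exists v w, [/\ carc u v, carc u w & carc v w].

Definition has_common_target u := exists v v' w,
  [/\ v != v', [/\ carc u v, carc u v' & carc u w], carc v w & carc v' w].

Lemma caut_triangle s u : caut s -> has_triangle u -> has_triangle (s u).
Proof. by move=> s_aut [v [w tri]]; exists (s v), (s w); rewrite !s_aut. Qed.

Lemma caut_common_target s u :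
  caut s -> has_common_target u -> has_common_target (s u).
Proof.
move=> s_aut [v [v' [w ct]]]; exists (s v), (s v'), (s w).
by rewrite !s_aut inj_eq //; apply: perm_inj.
Qed.

Section Fixed.

Variables (s : {perm gT * I}).
Hypotheses (s_aut : caut s) (s_layer : forall u, (s u).2 = u.2).

Lemma caut_arc_layer g i t j : s (g, i) = (g, i) -> (t, j) \in N i ->
  exists2 t', (t', j) \in N i & s (t * g, j) = (t' * g, j).
Proof.
move=> fix_g Ntj.
have: carc (s (g, i)) (s (t * g, j)).
  by rewrite s_aut -{1}[g]mul1g carcM carc1.
rewrite fix_g => /carcP[[t' j'] /= Nt' e].
have := s_layer (t * g, j); rewrite e /= => ej; subst j'.
by exists t'.
Qed.

End Fixed.

End MCayleyDigraph.

(** * Three-regular m-Cayley digraphs *)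

Section RigidMCayley.

Variables (gT : finGroupType) (I : finType) (f h : I -> I) (c a b : I -> gT).

(** The lone out-neighbour in layer [f i] is fixed by every layer-preserving automorphism fixing the
    source, whereas the two in layer [h i] may still be swapped. *)
Definition nbrs i := [:: (c i, f i); (a i, h i); (b i, h i)].

Hypotheses (f_inj : injective f) (h_inj : injective h).
Hypotheses (fh : forall i, f i != h i) (ab : forall i, a i != b i).
Hypothesis asym : forall i v, v \in nbrs i -> ~~ carc nbrs v (1, i).

Variable i0 : I.
Hypothesis layer_i0 : forall s, caut nbrs s -> (s (1, i0)).2 = i0.
Hypothesis rigid :
  forall s, caut nbrs s -> s (1, i0) = (1, i0) -> forall u, s u = u.

Lemma vertices_gt0 : 0 < #|{: gT * I}|.
Proof. by apply/card_gt0P; exists (1, i0). Qed.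

Definition mCayley := Digraph (carc nbrs) vertices_gt0.

Lemma mCayley_asym (u v : mCayley) : carc nbrs u v -> ~~ carc nbrs v u.
Proof.
case: u => g i /carcP[[t j] /= /asym nv ->].
by rewrite -{2}[g]mul1g carcM.
Qed.

Lemma mCayley_oriented : oriented mCayley.
Proof.
split=> [u v _ [/mCayley_asym/negP] // | u uu].
by have := mCayley_asym uu; rewrite (uu : carc _ u u).
Qed.

Lemma mCayley_out (u : mCayley) : out_valency u = 3.
Proof.
case: u => g i; rewrite /out_valency.
have -> : [set v | carc nbrs (g, i) v] = [set shift I g p | p in nbrs i].
  apply/setP=> v; rewrite inE; apply/carcP/imsetP => -[p Np ->]; exists p => //.
    by rewrite permE.
  by rewrite permE.
rewrite card_imset; last exact: perm_inj.
apply/card_uniqP; rewrite /= !inE !xpair_eqE (negPf (fh i)) !andbF /=.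
by rewrite (negPf (ab i)).
Qed.

Lemma mCayley_in (u : mCayley) : in_valency u = 3.
Proof.
case: u => g j; change (#|[set v | carc nbrs v (g, j)]| = 3).
pose f' := invF f_inj; pose h' := invF h_inj.
have fK: cancel f f' by apply: invF_f.
have f'K: cancel f' f by apply: f_invF.
have hK: cancel h h' by apply: invF_f.
have h'K: cancel h' h by apply: f_invF.
(* [M] pairs each arc label leading into layer [j] with the layer it comes from; [back] converts a
   label [r] into the source [r^-1 * g] of the arc ending at [g]. *)
pose M := [:: (c (f' j), f' j); (a (h' j), h' j); (b (h' j), h' j)].
pose back (p : gT * I) : gT * I := (p.1^-1 * g, p.2).
have back_inj: injective back.
  by move=> [t i] [t' i'] [/mulIg/invg_inj-> ->].
have -> : [set v | carc nbrs v (g, j)] = [set back p | p in M].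
  apply/setP=> -[t i]; rewrite inE /= /carc /=.
  transitivity ((g * t^-1, i) \in M); last first.
    rewrite -(mem_imset _ _ back_inj) /back /=.
    by rewrite invMg invgK mulgKV.
  rewrite !inE !xpair_eqE.
  have ef: (j == f i) = (i == f' j) by apply/eqP/eqP => ->.
  have eh: (j == h i) = (i == h' j) by apply/eqP/eqP => ->.
  rewrite ef eh; case: (i =P f' j) => [<-|_]; case: (i =P h' j) => [<-|_];
    by rewrite ?andbF ?andbT.
rewrite (card_imset _ back_inj); apply/card_uniqP; rewrite /= !inE !xpair_eqE.
have fh': f' j != h' j.
  by apply: contra (fh (f' j)) => /eqP e; rewrite f'K e h'K.
by rewrite (negPf fh') !andbF /= (negPf (ab _)).
Qed.

Lemma mCayley_aut : digraph_aut mCayley = shift_morphism gT I @* [set: gT].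
Proof.
apply/eqP; rewrite eqEsubset; apply/andP; split; apply/subsetP=> s; last first.
  case/morphimP=> g _ _ ->; apply/digraph_autP => u v.
  exact/esym/shift_aut.
move/digraph_autP=> s_aut'.
have s_aut: caut nbrs s by move=> u v; apply/esym/s_aut'.
have [g eg]: exists g, s (1, i0) = (g, i0).
  by have := layer_i0 s_aut; case: (s _) => g i /= ->; exists g.
have -> : s = shift I g; last by apply: mem_morphim; rewrite inE.
(* Undoing the translation by [g] leaves an automorphism fixing [(1, i0)], which is trivial by
   [rigid]. *)
apply/(mulIg (shift I g)^-1)/permP=> u; rewrite mulgV perm1.
apply: rigid => [v w|].
  by rewrite !permM cautV ?s_aut //; apply: shift_aut.
by rewrite permM eg -[X in (X, i0)](mul1g g) -shiftE permK.
Qed.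

Lemma shift_isog : shift_morphism gT I @* [set: gT] \isog [set: gT].
Proof.
rewrite isog_sym sub_isog ?subxx //; apply/injmP=> g g' _ _ /permP/(_ (1, i0)).
by rewrite /= !shiftE !mul1g => -[].
Qed.

Lemma mCayley_OmSR : admits_OmSR [set: gT] #|I| 3.
Proof.
exists mCayley; split; first exact: mCayley_oriented.
- by move=> u; rewrite mCayley_out mCayley_in.
- exists (shift_morphism gT I @* [set: gT])%G; split.
  + by rewrite mCayley_aut.
  + exact: shift_isog.
  + move=> [g i]; apply/trivgP/subsetP=> s /setIP[/morphimP[t _ _ ->]].
    move/astab1P; rewrite /= /aperm shiftE => -[/(canRL (mulKg g))].
    rewrite mulVg => ->; rewrite inE; apply/eqP/permP=> -[g' j].
    by rewrite shiftE perm1 mulg1.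
  (* The orbits of the translations are the layers, so there are [#|I|] of them. *)
  + pose layer i : {set gT * I} := [set u | u.2 == i].
    have layer_inj: injective layer.
      by move=> i j /setP/(_ (1, i)); rewrite !inE eqxx => /esym/eqP.
    rewrite -cardsT -(card_imset _ layer_inj) /vertex_orbits.
    have orbE (u : mCayley) :
        orbit 'P (shift_morphism gT I @* [set: gT]) u = layer u.2.
      case: u => g i; apply/setP=> -[g' j]; rewrite inE /=.
      apply/orbitP/eqP => [[s /morphimP[t _ _ ->]] | ->].
        by rewrite /= /aperm shiftE => -[].
      exists (shift I (g^-1 * g')); first by apply: mem_morphim; rewrite inE.
      by rewrite /= /aperm shiftE mulKVg.
    congr #|pred_of_set _|; apply/setP=> A.
    apply/imsetP/imsetP => [[u _ ->]|[i _ ->]].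
      by exists u.2; rewrite ?inE // orbE.
    by exists ((1, i) : mCayley); rewrite ?inE // orbE.
by rewrite mCayley_aut shift_isog.
Qed.

End RigidMCayley.

(** * Propagation of fixed vertices along arcs *)

Section FixedNeighbours.

Variables (gT : finGroupType) (I : finType) (f h : I -> I) (c a b : I -> gT).
Hypotheses (fh : forall i, f i != h i) (ab : forall i, a i != b i).

Lemma mem_nbrs t i j : ((t, j) \in nbrs f h c a b i) =
  (j == f i) && (t == c i) || (j == h i) && (t \in [:: a i; b i]).
Proof.
rewrite !inE !xpair_eqE.
by case: (j =P f i) => _; case: (j =P h i) => _; rewrite ?andbF ?andbT.
Qed.

Variables (s : {perm gT * I}).
Hypothesis s_aut : caut (nbrs f h c a b) s.
Hypothesis s_layer : forall u, (s u).2 = u.2.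

Lemma fix_c g i : s (g, i) = (g, i) -> s (c i * g, f i) = (c i * g, f i).
Proof.
move=> fix_g.
have [|t] := caut_arc_layer s_aut s_layer (t := c i) (j := f i) fix_g.
  by rewrite mem_nbrs !eqxx.
by rewrite mem_nbrs eqxx (negPf (fh i)) orbF => /eqP->.
Qed.

Lemma fix_ab t g i : s (g, i) = (g, i) -> t \in [:: a i; b i] ->
  exists2 t', t' \in [:: a i; b i] & s (t * g, h i) = (t' * g, h i).
Proof.
move=> fix_g t_ab.
have [|t'] := caut_arc_layer s_aut s_layer (t := t) (j := h i) fix_g.
  by rewrite mem_nbrs eqxx t_ab orbT.
rewrite mem_nbrs eqxx eq_sym (negPf (fh i)) /= => t'_ab ->.
by exists t'.
Qed.

Lemma fix_a_b g i : s (g, i) = (g, i) ->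
  s (a i * g, h i) = (a i * g, h i) -> s (b i * g, h i) = (b i * g, h i).
Proof.
move=> fix_g fix_a; have [|t] := @fix_ab (b i) g i fix_g.
  by rewrite !inE eqxx orbT.
rewrite !inE => /pred2P[]-> // eb; have := ab i.
by rewrite -fix_a in eb; case: (perm_inj eb) => /mulIg->; rewrite eqxx.
Qed.

(** In layer [h i], the fixed vertex [(g, i)] reaches [g] and [x * g], and the fixed vertex
    [(x * g, i)] reaches [x * g] and [x ^+ 2 * g]. As [x ^+ 2 != 1], their only common target is
    [x * g], which is therefore fixed, and then so is [g]. *)
Lemma fix_column x g i :
    f i = i -> c i = x -> a i = 1 -> b i = x -> x ^+ 2 != 1 ->
    s (g, i) = (g, i) ->
  [/\ s (x * g, i) = (x * g, i), s (g, h i) = (g, h i)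
    & s (x * g, h i) = (x * g, h i)].
Proof.
move=> ei ci ai bi x2 fix_g; have n1x: 1 != x by have := ab i; rewrite ai bi.
have fix_xg: s (x * g, i) = (x * g, i) by have := fix_c fix_g; rewrite ei ci.
have fix_xg': s (x * g, h i) = (x * g, h i).
  have := @fix_ab x _ _ fix_g; have := @fix_ab 1 _ _ fix_xg.
  rewrite ai bi !inE !eqxx orbT mul1g => /(_ isT)[t + ->] /(_ isT)[t'].
  rewrite !inE => /pred2P[]->; first by rewrite mul1g.
  rewrite mulgA => /pred2P[]-> [/mulIg].
    by move=> xx; case/eqP: x2.
  by rewrite -{3}[x]mulg1 => /mulgI e; rewrite e eqxx in n1x.
split=> //; have := fix_ab fix_g (t := 1); rewrite ai inE eqxx => /(_ isT)[t].
rewrite bi !inE => /pred2P[]->; rewrite !mul1g // -fix_xg' => /perm_inj[].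
by rewrite -{1}[g]mul1g => /mulIg e; rewrite e eqxx in n1x.
Qed.

End FixedNeighbours.

(** * A generator of order at least three *)

Section LoopedLayers.

Variables (gT : finGroupType) (I : finType) (h : I -> I) (c a b : I -> gT).
Local Notation N := (nbrs id h c a b).
Hypothesis (fh : forall i, i != h i).

(** Every vertex of layer [h i] has an in-neighbour in layer [i]. Its image is then an out-neighbour
    of layer [i], so in layer [i] or [h i], and the former is excluded because layer [i] is
    preserved. *)
Lemma caut_next_layer i :
    (forall s, caut N s -> forall u, ((s u).2 == i) = (u.2 == i)) ->
  forall s, caut N s -> forall u, ((s u).2 == h i) = (u.2 == h i).
Proof.
move=> lay_i; have lay s u: caut N s -> u.2 = h i -> (s u).2 = h i.
  case: u => g j s_aut /= ->.
  have: carc N (s ((a i)^-1 * g, i)) (s (g, h i)).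
    by rewrite s_aut /carc /= invMg invgK mulKVg !inE eqxx orbT.
  have /eqP := lay_i s s_aut ((a i)^-1 * g, i); rewrite eqxx => /eqP/eqP.
  case: (s _) => g' _ /= -> /carcP[p Np e].
  have := lay_i s s_aut (g, h i).
  rewrite e /= eq_sym [in RHS]eq_sym (negPf (fh i)).
  by move: Np; rewrite !inE => /or3P[]/eqP->; rewrite //= eqxx.
move=> s s_aut u; apply/eqP/eqP; last exact: lay.
by move/(lay s^-1 (s u) (cautV s_aut)); rewrite permK.
Qed.

End LoopedLayers.

(** * The cyclic successor on layers *)

Section OrdinalCycle.

Variable n : nat.
Implicit Type i : 'I_n.+1.

Lemma val_ordS i : i != ord_max -> ordS i = i.+1 :> nat.
Proof.
move=> ne; have lt_in : i < n by rewrite ltn_neqAle ne -ltnS ltn_ord.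
by rewrite /= modn_small.
Qed.

Lemma ordS_max : ordS (@ord_max n) = ord0.
Proof. by apply: val_inj; rewrite /= modnn. Qed.

Lemma ord0_neq_max : 0 < n -> ord0 != @ord_max n.
Proof. by rewrite -val_eqE /= eq_sym -lt0n. Qed.

Lemma val_iter_ordS k i : iter k (@ordS _) i = (i + k) %% n.+1 :> nat.
Proof.
elim: k => [|k IHk]; first by rewrite addn0 modn_small.
by rewrite [LHS]/= IHk -addn1 modnDml addn1 addnS.
Qed.

Lemma iter_ordS_eq k i : (i == iter k (@ordS _) i) = (n.+1 %| k).
Proof.
rewrite -val_eqE /= val_iter_ordS -{1}[i : nat]addn0.
rewrite -[X in X == _](@modn_small _ n.+1) ?addn0 // -[X in X %% _]addn0.
by rewrite eqn_modDl mod0n eq_sym.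
Qed.

Lemma ordS_neq i : 0 < n -> i != ordS i.
Proof. by move=> n_gt0; rewrite (iter_ordS_eq 1) dvdn1 -lt0n. Qed.

Lemma ordSS_neq i : 1 < n -> i != ordS (ordS i).
Proof. by move=> n_gt1; rewrite (iter_ordS_eq 2) gtnNdvd. Qed.

End OrdinalCycle.

(** * The cycle of layers for a generator [x] with [x ^+ 2 != 1] *)

Section LongCycle.

Variables (gT : finGroupType) (x y : gT) (n : nat).
Hypotheses (n_gt0 : 0 < n) (gen_xy : <<[set x; y]>> = [set: gT]).
Hypotheses (y_notin : y \notin <[x]>) (x2 : x ^+ 2 != 1).
Hypothesis (nx : (1 < n) || (x ^+ 3 != 1)).

Let c (i : 'I_n.+1) := x.
Let a (i : 'I_n.+1) := if i == ord_max then x ^+ 2 else 1.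
Let b (i : 'I_n.+1) := if i == ord_max then y else x.
Local Notation N := (nbrs id (@ordS n.+1) c a b).

Let yX k : y != x ^+ k.
Proof. by apply: contraNneq y_notin => ->; apply: mem_cycle. Qed.

Let x_neq1 : x != 1.
Proof. exact: expg_neq1 x2. Qed.

Let fh (i : 'I_n.+1) : i != ordS i.
Proof. exact: ordS_neq. Qed.

Let ab i : a i != b i.
Proof. by rewrite /a /b; case: ifP => _; rewrite eq_sym. Qed.

Let memN t i j : ((t, j) \in N i) =
  (j == i) && (t == x) || (j == ordS i) && (t \in [:: a i; b i]).
Proof. exact: mem_nbrs. Qed.

Let asym i v : v \in N i -> ~~ carc N v (1, i).
Proof.
case: v => t j; rewrite /carc /= mul1g !memN.
case/orP=> /andP[/eqP-> t_in]; rewrite ?eqxx /=.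
  by rewrite (negPf (fh i)) orbF (eqP t_in) eq_invg_id.
(* An arc to the next layer can be reversed only when there are two layers; [x ^+ 3 != 1] then keeps
   [x ^+ 2] from being inverse to [x]. *)
rewrite (negPf (fh i)) /=; have [n_gt1|n_le1] := ltnP 1 n.
  by rewrite (negPf (ordSS_neq i n_gt1)).
have x3: x ^+ 3 != 1 by move: nx; rewrite ltnNge n_le1.
have x2V: x ^+ 2 != x^-1 by rewrite -(inj_eq (mulIg x)) mulVg -expgSr.
have yV: y != x^-1 by apply: contraNneq y_notin => ->; rewrite groupV cycle_id.
rewrite negb_and; apply/orP; right; move: t_in; rewrite /a /b.
have [->|ne] := eqVneq i ord_max.
  rewrite ordS_max (negPf (ord0_neq_max n_gt0)) !inE.
  case/pred2P=> ->; rewrite negb_or !(inv_eq invgK) invg1 ?x2 //.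
  by rewrite yV (yX 0).
have -> : ordS i == ord_max.
  apply/eqP/val_inj/eqP; rewrite eqn_leq -ltnS ltn_ord /= (leq_trans n_le1) //.
  by rewrite -[X in _ < X]/(nat_of_ord (ordS i)) val_ordS.
rewrite !inE => /pred2P[]->; rewrite negb_or ?invg1.
  by rewrite [_ == x ^+ 2]eq_sym x2 eq_sym (yX 0).
by rewrite [_ == x ^+ 2]eq_sym x2V eq_sym yV.
Qed.

(** An arc among the out-neighbours [(x, ord_max)], [(x ^+ 2, ord0)] and [(y, ord0)] would force
    [x = 1], [x ^+ 2 = 1] or [y] to be a power of [x]. *)
Let no_arc v w :
  v \in N ord_max -> w \in N ord_max -> ~~ carc N v w.
Proof.
have xx : x * x = x ^+ 2 by rewrite expgS expg1.
have xxx : x ^+ 2 * x = x ^+ 3 by rewrite -expgSr.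
have n0 := ord0_neq_max n_gt0.
have n0' : ord_max != ord0 :> 'I_n.+1 by rewrite eq_sym.
have [nxy ny1] : x != y /\ y != 1 by rewrite eq_sym (yX 1) (yX 0).
have mulxE t : (t == x * t) = false by rewrite eq_mulgl_id (negPf x_neq1).
have mulEx t : (t == t * x) = false by rewrite eq_mulgr_id (negPf x_neq1).
case: v w => [t i] [t' i']; rewrite /carc /= !memN ordS_max /a /b eqxx.
case/orP=> /andP[/eqP-> t_in] /orP[]/andP[/eqP-> t'_in].
- by rewrite eqxx ordS_max (negPf n0') orbF (eqP t_in) (eqP t'_in) mulgV eq_sym.
- rewrite (negPf n0) ordS_max eqxx /= (eqP t_in) !inE !eq_divg negb_or.
  move: t'_in; rewrite eqxx !inE => /pred2P[]->.
    by rewrite mulEx -xx (inj_eq (mulIg x)).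
  by rewrite mulEx xxx yX.
- rewrite (negPf n0') /= (eqP t'_in) (negPf n0) !inE !eq_divg.
  rewrite negb_and negb_or; apply/orP; right.
  move: t_in; rewrite !inE => /pred2P[]->; rewrite mul1g.
    by rewrite -xx mulxE /= -{1}[x]mulg1 (inj_eq (mulgI x)) xx eq_sym.
  by rewrite nxy -{1}[x]mulg1 (inj_eq (mulgI x)) eq_sym.
rewrite eqxx (negPf (fh _)) orbF eq_divg.
move: t_in t'_in; rewrite !inE => /pred2P[]-> /pred2P[]->; rewrite ?mulxE //.
  by rewrite -expgS yX.
by rewrite -xx (inj_eq (mulgI x)).
Qed.

Let layers s : caut N s -> forall u, (s u).2 = u.2.
Proof.
move=> s_aut; have lay k: forall s, caut N s ->
    forall u, ((s u).2 == iter k (@ordS _) ord_max) =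
              (u.2 == iter k (@ordS _) ord_max).
  elim: k => /= [|k]; last exact: caut_next_layer.
  move=> {}s {}s_aut.
  apply: (caut_layer (Q := pred1 ord_max) s_aut).
    exact: caut_not (@caut_triangle _ _ N).
  move=> j; split=> [no_tri|/eqP->].
    apply: contraT => /= ne; case: no_tri.
    (* Before the last layer, the label [x] inside the layer followed by the label [1] to the next
       one has the same effect as the direct label [x]. *)
    exists (x, j), (x, ordS j); rewrite !carc1 /carc /= mulgV !memN !eqxx /a /b.
    by rewrite (negPf ne) !inE !eqxx !orbT.
  by case=> v [w []]; rewrite !carc1 => Nv Nw; apply/negP/no_arc.
move=> u; have [k ek]: exists k, u.2 = iter k (@ordS _) ord_max; last first.
  by rewrite ek; apply/eqP; rewrite lay ?ek.
(* The first step leads from the last layer to layer 0, hence one step more than [j]. *)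
case: u => _ [j ltj] /=; exists j.+1.
elim: j ltj => [|j IHj] ltj; apply: val_inj; first by rewrite /= modnn.
by have /(congr1 val)/= <- := IHj (ltnW ltj); rewrite modn_small.
Qed.

Let rigid s : caut N s -> s (1, ord0) = (1, ord0) -> forall u, s u = u.
Proof.
move=> s_aut s1; have s_lay := layers s_aut.
have col g i: i != ord_max -> s (g, i) = (g, i) ->
  [/\ s (x * g, i) = (x * g, i), s (g, ordS i) = (g, ordS i)
    & s (x * g, ordS i) = (x * g, ordS i)].
  move=> ne; apply: (fix_column fh ab s_aut s_lay) => //.
    by rewrite /a (negPf ne).
  by rewrite /b (negPf ne).
(* The column over [g] is followed upwards from layer 0; the wrap-around, whose labels differ, is
   never crossed here. *)
have fix_all g: s (g, ord0) = (g, ord0) -> forall i, s (g, i) = (g, i).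
  move=> sg [k ltk]; elim: k ltk => [|k IHk] ltk.
    by rewrite (_ : Ordinal _ = ord0) //; apply: val_inj.
  have ltk': k < n.+1 by apply: ltnW.
  have ne: Ordinal ltk' != ord_max by rewrite -val_eqE /= ltn_eqF.
  rewrite (_ : Ordinal _ = ordS (Ordinal ltk')); last first.
    by apply: val_inj; rewrite /= modn_small.
  by have [] := col g _ ne (IHk _).
pose A := [set g | s (g, ord0) == (g, ord0)].
suff AT: A = [set: gT].
  by case=> g i; apply: fix_all; apply/eqP; have := in_setT g; rewrite -AT inE.
have n0 := ord0_neq_max n_gt0.
apply: (left_closed_setT gen_xy) => [|g|g]; rewrite !inE ?s1 // => /eqP sg.
  by have [->] := col g _ n0 sg.
(* The two arcs from [(g, ord_max)] to layer 0 end at [x ^+ 2 * g] and [y * g]. Two steps by [x]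
   inside layer 0 fix the former, hence the latter is fixed too. *)
have sgm := fix_all g sg ord_max.
have [s1g _ _] := col _ _ n0 sg; have [s2g _ _] := col _ _ n0 s1g.
have := fix_a_b fh ab s_aut s_lay sgm.
rewrite /a /b eqxx ordS_max expgS expg1 -mulgA.
by move=> -> //.
Qed.

Lemma OmSR_long_cycle : admits_OmSR [set: gT] n.+1 3.
Proof.
rewrite -[n.+1]card_ord.
apply: (@mCayley_OmSR _ _ id (@ordS n.+1) c a b _ _ _ _ _ ord0) => //.
- exact: ordS_inj.
- by move=> s /layers->.
Qed.

End LongCycle.

(** * Two layers indexed by booleans *)

Section TwoLayers.

Variables (gT : finGroupType) (c a b : bool -> gT).
Local Notation N := (nbrs id negb c a b).

Lemma mem_nbrs2 t i j : ((t, j) \in N i) =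
  if j == i then t == c i else t \in [:: a i; b i].
Proof. by rewrite mem_nbrs; case: i j => -[]; rewrite ?orbF. Qed.

Lemma caut_layer2 (P : gT * bool -> Prop) :
    (forall s u, caut N s -> P u -> P (s u)) -> P (1, true) -> ~ P (1, false) ->
  forall s, caut N s -> forall u, (s u).2 = u.2.
Proof.
move=> Paut P1 P0 s s_aut u.
by apply: (caut_layer (Q := id) (P := P) s_aut) => // -[].
Qed.

Lemma OmSR_two_layers :
    (forall i, a i != b i) ->
    (forall i v, v \in N i -> ~~ carc N v (1, i)) ->
    (forall s, caut N s -> (forall u, (s u).2 = u.2)) ->
    (forall s, caut N s -> s (1, false) = (1, false) -> forall u, s u = u) ->
  admits_OmSR [set: gT] 2 3.
Proof.
move=> ab asym layers rigid; rewrite -[X in admits_OmSR _ X]card_bool.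
apply: (mCayley_OmSR (f := id) (h := negb) (i0 := false) _ _ _ ab asym) => //.
- exact: negb_inj.
- by case.
- by move=> s /layers->.
Qed.

End TwoLayers.

(** * Two layers with non-commuting generators *)

Section NonCommutingTwoLayers.

Variables (gT : finGroupType) (x y : gT).
Hypotheses (gen_xy : <<[set x; y]>> = [set: gT]) (y_notin : y \notin <[x]>).
Hypotheses (x2 : x ^+ 2 != 1) (xy_neq : x * y != y * x).

Let c (i : bool) := x.
Let a (i : bool) := if i then y else 1.
Let b (i : bool) := if i then x * y else x.
Local Notation N := (nbrs id negb c a b).

Let x_neq1 : x != 1.
Proof. exact: expg_neq1 x2. Qed.

Let xy_notin : x * y \notin <[x]>. Proof. by rewrite groupMl ?cycle_id. Qed.

Let mulxE t : (t == x * t) = false.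
Proof. by rewrite eq_mulgl_id (negPf x_neq1). Qed.

Let xV : (x^-1 == x) = false.
Proof. by rewrite eq_invg_id (negPf x2). Qed.

Let ab i : a i != b i.
Proof. by case: i => /=; [rewrite mulxE | rewrite eq_sym]. Qed.

Let asym i v : v \in N i -> ~~ carc N v (1, i).
Proof.
have H1 := group1 <[x]>; have Hx := cycle_id x.
have HV : x^-1 \in <[x]> by rewrite groupV.
case: v => t j; rewrite /carc /= mul1g !mem_nbrs2 [i == j]eq_sym.
case: eqP => [<- /eqP->|]; first by rewrite xV.
case: i j => -[] // _; rewrite !inE => /pred2P[]->.
- by rewrite !(inv_eq invgK) invg1 !(neq_notin y_notin).
- by rewrite !(inv_eq invgK) invg1 !(neq_notin xy_notin).
- by rewrite invg1 (neq_notin y_notin) // (neq_notin xy_notin).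
by rewrite (neq_notin y_notin) // (neq_notin xy_notin).
Qed.

(** In this out-neighbourhood the target of an arc determines its source, so there is no common
    target. Non-commutation excludes an arc from [(x, true)] to [(x * y, false)], which already
    receives one from [(y, false)]. *)
Let unique_arc v w : v \in N true -> w \in N true -> carc N v w ->
  v = if w == (x * y, false) then (y, false) else (x, true).
Proof.
case: v w => t i [t' i']; rewrite /carc /= !mem_nbrs2.
have Hx := cycle_id x; have xx_in : x * x \in <[x]> by apply: groupM.
case: i i' => -[] /=.
- by move=> /eqP-> /eqP->; rewrite mulgV eq_sym (negPf x_neq1).
- move=> /eqP-> + ; rewrite !inE !eq_divg => /pred2P[]->.
    by rewrite xpair_eqE mulxE.
  by rewrite (negPf xy_neq) eq_mulgr_id (negPf x_neq1).
- move=> + /eqP->; rewrite !inE !eq_divg mul1g => /pred2P[]->.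
    by rewrite (neq_notin y_notin) ?(neq_notin xy_notin).
  rewrite (neq_notin xy_notin) //= /c -{1}[x]mulg1 (inj_eq (mulgI x)).
  by rewrite (neq_notin xy_notin).
move=> t_in t'_in; rewrite eq_divg; move: t_in t'_in.
rewrite !inE => /pred2P[]-> /pred2P[]->; rewrite ?eqxx //.
- by rewrite mulxE.
- rewrite mulgA -{1}[y]mul1g (inj_eq (mulIg y)) eq_sym.
  by rewrite -[x * x](expgS x 1) (negPf x2).
by rewrite mulxE.
Qed.

Let layers s : caut N s -> forall u, (s u).2 = u.2.
Proof.
apply: (caut_layer2 (caut_not (@caut_common_target _ _ N))).
  case=> v [v' [w []]]; rewrite !carc1 => nvv' [Nv Nv' Nw] vw v'w.
  by rewrite (unique_arc Nv Nw vw) (unique_arc Nv' Nw v'w) eqxx in nvv'.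
apply; exists (x, false), (1, true), (x, true).
by rewrite !carc1 /carc /= mulgV !mem_nbrs2 xpair_eqE /= andbF !inE !eqxx ?orbT.
Qed.

Let rigid s : caut N s -> s (1, false) = (1, false) -> forall u, s u = u.
Proof.
move=> s_aut s1; have s_lay := layers s_aut; have fh i : i != ~~ i by case: i.
have col g : s (g, false) = (g, false) -> [/\ s (x * g, false) = (x * g, false),
  s (g, true) = (g, true) & s (x * g, true) = (x * g, true)].
  by move=> sg; apply: (fix_column fh ab s_aut s_lay).
pose A := [set g | s (g, false) == (g, false)].
suff AT: A = [set: gT].
  have sf g : s (g, false) = (g, false).
    by apply/eqP; have := in_setT g; rewrite -AT inE.
  by case=> g [] //; have [] := col g (sf g).
apply: (left_closed_setT gen_xy) => [|g|g]; rewrite !inE ?s1 // => /eqP sg.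
  by have [->] := col g sg.
have [_ sgt _] := col g sg.
have := fix_ab fh s_aut s_lay sgt (t := y).
have := fix_ab fh s_aut s_lay sgt (t := x * y).
rewrite !inE !eqxx orbT => /(_ isT)[t t_in et] /(_ isT)[t' t'_in e'].
move: t'_in t_in; rewrite !inE => /pred2P[] et' t_in; first by rewrite e' et'.
rewrite {t'}et' in e'.
case/pred2P: t_in et => -> et.
  (* If the two targets were swapped, the arc labelled [x] between them would be reversed, contrary
     to [x ^+ 2 != 1]. *)
  have : carc N (s (y * g, false)) (s (x * y * g, false)).
    by rewrite s_aut carcM /carc /= mulgK !inE eqxx.
  by rewrite et e' carcM /carc /= invMg mulgA mulgV mul1g mem_nbrs2 eqxx /= xV.
by rewrite -et in e'; case: (perm_inj e') => /mulIg/eqP; rewrite mulxE.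
Qed.

Lemma OmSR2_noncommuting : admits_OmSR [set: gT] 2 3.
Proof. exact: OmSR_two_layers ab asym layers rigid. Qed.

End NonCommutingTwoLayers.

(** * Two layers with [y] of order three *)

Section OrderThreeTwoLayers.

Variables (gT : finGroupType) (x y : gT).
Hypotheses (gen_xy : <<[set x; y]>> = [set: gT]) (y_notin : y \notin <[x]>).
Hypotheses (x2 : x ^+ 2 != 1) (y3 : y ^+ 3 = 1).

Let c (i : bool) := if i then y else x.
Let a (i : bool) := if i then x * y else 1.
Let b (i : bool) := if i then y^-1 else x.
Local Notation N := (nbrs id negb c a b).

Let yy : y * y = y^-1.
Proof. by apply: (mulIg y); rewrite mulVg -y3 !expgS expg0 mulg1 mulgA. Qed.

Let x_neq1 : x != 1.
Proof. exact: expg_neq1 x2. Qed.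

Let yV_notin : y^-1 \notin <[x]>. Proof. by rewrite groupV. Qed.

Let xy_notin : x * y \notin <[x]>. Proof. by rewrite groupMl ?cycle_id. Qed.

Let mulxE t : (t == x * t) = false.
Proof. by rewrite eq_mulgl_id (negPf x_neq1). Qed.

Let xV : (x^-1 == x) = false.
Proof. by rewrite eq_invg_id (negPf x2). Qed.

Let yV : (y == y^-1) = false.
Proof.
apply: contraNF y_notin => /eqP; rewrite -yy -{1}[y]mulg1 => /mulgI <-.
exact: group1.
Qed.

Let xy_yV : (x * y == y^-1) = false.
Proof. by rewrite -yy (inj_eq (mulIg y)) (neq_notin y_notin) ?cycle_id. Qed.

Let ab i : a i != b i.
Proof. by case: i; rewrite /a /b ?xy_yV // eq_sym. Qed.

Let asym i v : v \in N i -> ~~ carc N v (1, i).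
Proof.
have H1 := group1 <[x]>; have Hx := cycle_id x.
have HV : x^-1 \in <[x]> by rewrite groupV.
case: v => t j; rewrite /carc /= mul1g !mem_nbrs2 [i == j]eq_sym.
case: eqP => [<- /eqP->|].
  by case: j; rewrite /c ?xV // eq_sym yV.
case: i j => -[] // _; rewrite !inE => /pred2P[]->.
- by rewrite !(inv_eq invgK) invg1 !(neq_notin xy_notin).
- by rewrite invgK !(neq_notin y_notin).
- by rewrite invg1 (neq_notin xy_notin) // (neq_notin yV_notin).
by rewrite (neq_notin xy_notin) // (neq_notin yV_notin).
Qed.

(** Since [y * y = y^-1], each possible arc would force [y] into [<[x]>] or [x ^+ 2 = 1]. *)
Let no_arc v w : v \in N true -> w \in N true -> ~~ carc N v w.
Proof.
have H1 := group1 <[x]>; have Hx := cycle_id x.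
have Hxx : x * x \in <[x]> by apply: groupM.
case: v w => t i [t' i']; rewrite /carc /= !mem_nbrs2.
case: i i' => -[] /=.
- by move=> /eqP-> /eqP->; rewrite mulgV (neq_notin y_notin).
- move=> /eqP->; rewrite !inE !eq_divg mulVg -mulgA yy => /pred2P[]->.
    by rewrite (inj_eq (mulgI x)) yV (neq_notin xy_notin).
  by rewrite mulxE (neq_notin yV_notin).
- move=> + /eqP->; rewrite !inE !eq_divg mul1g => /pred2P[]->.
    rewrite /c mulxE /= mulgA -{1}[y]mul1g (inj_eq (mulIg y)) eq_sym.
    by rewrite -[x * x](expgS x 1).
  by rewrite /c yV /= -(inj_eq (mulIg y)) mulgKV yy (neq_notin yV_notin).
move=> t_in t'_in; rewrite eq_divg; move: t_in t'_in.
rewrite !inE => /pred2P[]-> /pred2P[]->; rewrite ?mulxE //.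
  by rewrite -yy mulgA (inj_eq (mulIg y)) (neq_notin y_notin).
by rewrite (inj_eq (mulgI x)) yV.
Qed.

Let layers s : caut N s -> forall u, (s u).2 = u.2.
Proof.
apply: (caut_layer2 (caut_not (@caut_triangle _ _ N))).
  by case=> v [w []]; rewrite !carc1 => Nv Nw; apply/negP/no_arc.
apply; exists (x, false), (x, true).
by rewrite !carc1 /carc /= mulgV !mem_nbrs2 /= !inE !eqxx ?orbT.
Qed.

Let rigid s : caut N s -> s (1, false) = (1, false) -> forall u, s u = u.
Proof.
move=> s_aut s1; have s_lay := layers s_aut; have fh i : i != ~~ i by case: i.
have col g : s (g, false) = (g, false) -> [/\ s (x * g, false) = (x * g, false),
  s (g, true) = (g, true) & s (x * g, true) = (x * g, true)].
  by move=> sg; apply: (fix_column fh ab s_aut s_lay).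
(* The in-neighbours of [(g, true)] in layer [false] are [g] and [x^-1 * g], joined by an arc from
   the second to the first. They are permuted by [s], and the arc between them forbids a swap. *)
have back g : s (g, true) = (g, true) -> s (g, false) = (g, false).
  move=> sg.
  have pre z : carc N (z, false) (g, true) -> z = g \/ z = x^-1 * g.
    rewrite /carc /= mem_nbrs2 !inE !eq_divg mul1g => /pred2P[]->.
      by left.
    by right; rewrite mulKg.
  have arc_g : carc N (g, false) (g, true).
    by rewrite /carc /= mulgV !inE eqxx ?orbT.
  have arc_xg : carc N (x^-1 * g, false) (g, true).
    by rewrite /carc /= invMg invgK mulKVg !inE eqxx ?orbT.
  have arcs : carc N (x^-1 * g, false) (g, false).
    by rewrite /carc /= invMg invgK mulKVg !inE eqxx ?orbT.
  have img z : carc N (z, false) (g, true) ->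
      s (z, false) = (g, false) \/ s (z, false) = (x^-1 * g, false).
    rewrite -s_aut sg; have := s_lay (z, false); case: (s _) => z' j /= ->.
    by move/pre=> [->|->]; [left | right].
  case: (img _ arc_g) => // sg'; case: (img _ arc_xg) => sx.
    move: arcs; rewrite -s_aut sx sg' /carc /= mulgK mem_nbrs2 eqxx /c /=.
    by rewrite xV.
  have /perm_inj[e] : s (x^-1 * g, false) = s (g, false) by rewrite sx sg'.
  by rewrite sg' e.
pose A := [set g | s (g, false) == (g, false)].
suff AT: A = [set: gT].
  have sf g : s (g, false) = (g, false).
    by apply/eqP; have := in_setT g; rewrite -AT inE.
  by case=> g [] //; have [] := col g (sf g).
apply: (left_closed_setT gen_xy) => [|g|g]; rewrite !inE ?s1 // => /eqP sg.
  by have [->] := col g sg.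
have [_ sgt _] := col g sg.
(* Multiplication by [y] happens inside layer [true], whose inner label is [y]. *)
by apply/eqP/back; apply: (fix_c fh s_aut s_lay sgt).
Qed.

Lemma OmSR2_order3 : admits_OmSR [set: gT] 2 3.
Proof. exact: OmSR_two_layers ab asym layers rigid. Qed.

End OrderThreeTwoLayers.

(** * The Klein group *)

Section KleinCycle.

Variables (gT : finGroupType) (x y : gT) (n : nat).
Hypotheses (n_gt1 : 1 < n) (gen_xy : <<[set x; y]>> = [set: gT]).
Hypotheses (x2 : x ^+ 2 = 1) (y2 : y ^+ 2 = 1) (xy_comm : commute x y).
Hypotheses (x_neq1 : x != 1) (y_notin : y \notin <[x]>).

Local Notation S := (@ordS n.+1).
Local Notation last i := (i == ord_max :> 'I_n.+1).

(* Coordinates in the Klein group <[x]> * <[y]>, reducing equations between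
   words in x and y to booleans. *)
Let e (p q : bool) := x ^+ p * y ^+ q.
(** Away from the end [c] and [b] are both [x]. One layer before the last [c] is [y], and in the
    last layer [c] is [x * y] and [b] is [y]; this leaves a single arc inside the out-neighbourhoods
    of these two layers. *)
Let c i := e (~~ last (S i)) (last i || last (S i)).
Let a (i : 'I_n.+1) := e false false.
Let b i := e (~~ last i) (last i).
Local Notation N := (nbrs (S \o S) S c a b).

Let e0 : e false false = 1.
Proof. by rewrite /e mulg1. Qed.

Let e_div p q p' q' : e p q * (e p' q')^-1 = e (p (+) p') (q (+) q').
Proof.
have yV : y^-1 = y by apply: (mulgI y); rewrite mulgV -[y * y](expgS y 1) y2.
have xV : x^-1 = x by apply: (mulgI x); rewrite mulgV -[x * x](expgS x 1) x2.
have xx (r r' : bool) : x ^+ r * x ^- r' = x ^+ (r (+) r').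
  by case: r r' => -[]; rewrite ?expg0 ?expg1 ?invg1 ?mulg1 ?mul1g ?mulgV.
have yy (r r' : bool) : y ^+ r * y ^- r' = y ^+ (r (+) r').
  by case: r r' => -[]; rewrite ?expg0 ?expg1 ?invg1 ?mulg1 ?mul1g ?mulgV.
rewrite /e invMg mulgA -(mulgA (x ^+ p)) yy -xx -!mulgA.
by congr (_ * _); apply/commuteV/commuteX2/commute_sym.
Qed.

Let e_eq p q p' q' : (e p q == e p' q') = (p == p') && (q == q').
Proof.
have e1 r r' : (e r r' == 1) = ~~ r && ~~ r'.
  case: r r' => -[]; rewrite /e ?expg0 ?expg1 ?mul1g ?mulg1;
    rewrite ?eqxx ?(negPf x_neq1) //.
    apply: contraNF y_notin; rewrite eq_sym -(inj_eq (mulgI x^-1)) mulKg mulg1.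
    by move/eqP<-; rewrite groupV cycle_id.
  by apply: contraNF y_notin => /eqP->; apply: group1.
rewrite -(inj_eq (mulIg (e p' q')^-1)) mulgV e_div e1.
by case: p q p' q' => -[] [] [].
Qed.

Let fh i : (S \o S) i != S i.
Proof. by rewrite /= eq_sym ordS_neq // ltnW. Qed.

Let ab i : a i != b i.
Proof. by rewrite e_eq; case: (last i). Qed.

Let S3 i : i == S (S (S i)) -> n = 2.
Proof.
rewrite (iter_ordS_eq 3) => /(dvdn_leq (isT : 0 < 3)) n_lt3.
by apply/eqP; rewrite eqn_leq n_gt1 andbT.
Qed.

Let S4 i : i == S (S (S (S i))) -> n = 3.
Proof.
by rewrite (iter_ordS_eq 4); case: n n_gt1 => [|[|[|[|k]]]].
Qed.

Let i_S i : (i == S i) = false.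
Proof. by apply/negbTE/ordS_neq/ltnW. Qed.

Let i_SS i : (i == S (S i)) = false.
Proof. by apply/negbTE/ordSS_neq. Qed.

Let memN t i j : ((t, j) \in N i) =
  (j == S (S i)) && (t == c i) || (j == S i) && (t \in [:: a i; b i]).
Proof. exact: mem_nbrs. Qed.

Let lastE k i : last (iter k S i) = ((i + k) %% n.+1 == n).
Proof. by rewrite -val_eqE /= val_iter_ordS. Qed.

(** With three or four layers, the possible positions of the last layer form a finite list of truth
    values, on which labels are compared by cases. *)
Let S3_last i : i == S (S (S i)) -> (last i, last (S i), last (S (S i))) \in
  [:: (true, false, false); (false, true, false); (false, false, true)].
Proof.
move/S3=> n2; rewrite (lastE 0) (lastE 1) (lastE 2).
by have := ltn_ord i; move: (i : nat); rewrite n2 => -[|[|[|]]].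
Qed.

Let S4_last i : i == S (S (S (S i))) ->
  (last i, last (S i), last (S (S i)), last (S (S (S i)))) \in
  [:: (true, false, false, false); (false, true, false, false);
      (false, false, true, false); (false, false, false, true)].
Proof.
move/S4=> n3; rewrite (lastE 0) (lastE 1) (lastE 2) (lastE 3).
by have := ltn_ord i; move: (i : nat); rewrite n3 => -[|[|[|[|]]]].
Qed.

Let mem_ab p q i : (e p q \in [:: a i; b i]) =
  ~~ p && ~~ q || (p == ~~ last i) && (q == last i).
Proof. by rewrite !inE !e_eq; case: p q => -[]. Qed.

(** Labels are their own inverses, so opposite arcs need equal labels: two values of [c] at distance
    two when there are four layers, or a value of [c] and one of [a] or [b] when there are three. *)
Let asym i v : v \in N i -> ~~ carc N v (1, i).
Proof.
case: v => t j; rewrite /carc /= memN -e0.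
case/orP=> /andP[/eqP->].
  move/eqP->; rewrite e_div memN e_eq mem_ab; apply/norP; split; apply/negP.
    case/andP=> /S4_last; case: (last i) (last (S i)) => -[] //;
    by case: (last (S (S i))) (last (S (S (S i)))) => -[].
  case/andP=> /S3_last; case: (last i) (last (S i)) => -[] //;
  by case: (last (S (S i))).
case: (boolP (i == S (S (S i)))) => [i3|n3]; last first.
  by move=> _; rewrite memN (negPf n3) i_SS.
have i3l := S3_last i3.
suff c_ab t' :
    t' \in [:: a i; b i] -> (e false false * t'^-1 == c (S i)) = false.
  by move/c_ab; rewrite memN i3 i_SS => ->.
rewrite /c !inE => /pred2P[]->; rewrite e_div e_eq; move: i3l;
  by case: (last i) (last (S i)) => -[] //; case: (last (S (S i))).
Qed.

(* The last two layers are the only ones where no two out-neighbours have a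
   common out-neighbour inside the out-neighbourhood. *)
Let near_end i := last i || last (S i).

(** An inner arc must run from layer [S i] to [(c i, S (S i))], with label the quotient of [c i] by
    [a i] or [b i]; near the end only one of these quotients is a label of layer [S i]. *)
Let unique_arc i v w : near_end i -> v \in N i -> w \in N i -> carc N v w ->
  v = (e false (last i), S i) /\ w = (c i, S (S i)).
Proof.
move=> i_end; case: v w => t j [t' j']; rewrite /carc /= !memN.
case/orP=> /andP[/eqP-> t_in] /orP[]/andP[/eqP-> t'_in].
- by rewrite i_SS i_S.
- rewrite i_SS orbF (inj_eq (@ordS_inj _)) => /andP[i3]; rewrite (eqP t_in).
  move: i_end t'_in (S3_last i3); rewrite !inE /near_end /a /b /c -(eqP i3).
  move=> i_end /pred2P[]->; rewrite e_div e_eq; move: i_end;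
    by case: (last i) (last (S i)) => -[] //; case: (last (S (S i))).
- rewrite i_S eqxx /= => t_div; move: t_in t_div; rewrite (eqP t'_in) !inE.
  have l2 : last i -> last (S i) = false.
    by move/eqP->; rewrite ordS_max; apply/negbTE/ord0_neq_max/ltnW.
  case/pred2P=> ->; rewrite e_div !e_eq /a /b; move: i_end l2;
    by rewrite /near_end; case: (last i); case: (last (S i)) => //= _ /(_ isT).
by rewrite i_SS i_S.
Qed.

Let near_end_max : near_end ord_max.
Proof. by rewrite /near_end eqxx. Qed.

Let last_S i : last i -> last (S i) = false.
Proof. by move/eqP->; rewrite ordS_max; apply/negbTE/ord0_neq_max/ltnW. Qed.

Let common_target i : ~ has_common_target N (1, i) <-> near_end i.
Proof.
split=> [no_ct | i_end [v [v' [w []]]]]; last first.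
  rewrite !carc1 => nvv' [Nv Nv' Nw] vw v'w; move: nvv'.
  have [-> _] := unique_arc i_end Nv Nw vw.
  by have [-> _] := unique_arc i_end Nv' Nw v'w; rewrite eqxx.
apply: contraT; rewrite negb_or => /andP[/negPf ni /negPf nSi]; case: no_ct.
(* Away from the end [c i = x], and the labels [x] and [1] of layer [S i] reach it from [1] and from
   [x]. *)
exists (e false false, S i), (e true false, S i), (e true false, S (S i)).
split; first by rewrite xpair_eqE e_eq.
- by rewrite !carc1 !memN !mem_ab /c ni nSi !eqxx !orbT.
- by rewrite /carc /= e_div memN mem_ab nSi !eqxx orbT.
by rewrite /carc /= e_div memN mem_ab nSi !eqxx orbT.
Qed.

Let caut_near_end s : caut N s -> forall u, near_end (s u).2 = near_end u.2.
Proof.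
move=> s_aut; apply: (caut_layer (Q := near_end) s_aut) common_target.
exact: caut_not (@caut_common_target _ _ N).
Qed.

(** Were [s u] in the layer before the last, its two out-neighbours in the last layer would pull
    back to out-neighbours of [u] in layers near the end. At most one exists, the one labelled
    [c ord_max], contradicting injectivity. *)
Let caut_max s u : caut N s -> last u.2 -> last (s u).2.
Proof.
case: u => g j s_aut /= /eqP->{j}; have := caut_near_end s_aut (g, ord_max).
rewrite near_end_max; case Es: (s _) => [g' i] /=; case/orP=> // Si.
have ni : last i = false by apply: contraTF Si => /last_S->.
have s'_aut := cautV s_aut.
have to_SS p : carc N (g', i) (e p false * g', S i) ->
    s^-1 (e p false * g', S i) = (c ord_max * g, S (S ord_max)).
  rewrite -Es -s'_aut permK => /carcP[[t j] /= Nt es].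
  have := caut_near_end s'_aut (e p false * g', S i).
  rewrite es /= {2}/near_end Si /=; move: Nt; rewrite memN.
  case/orP=> /andP[/eqP-> t_in] j_end; first by rewrite (eqP t_in).
  by move: j_end; rewrite /near_end last_S ?eqxx // eq_sym i_SS.
have arc_p p : carc N (g', i) (e p false * g', S i).
  by rewrite /carc /= mulgK memN mem_ab ni eqxx; case: p; rewrite ?orbT.
have := to_SS true (arc_p true); rewrite -(to_SS false (arc_p false)).
by move/perm_inj=> [/mulIg/eqP]; rewrite e_eq.
Qed.

Let layers s : caut N s -> forall u, (s u).2 = u.2.
Proof.
move=> s_aut u; suff layers_ge k : forall (s : {perm gT * 'I_n.+1}), caut N s ->
    forall u : gT * 'I_n.+1, n - k.+1 <= u.2 -> (s u).2 = u.2.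
  (* The subtraction is truncated, so [k = n] covers all layers; the induction descends from the
     last two. *)
  by apply: (layers_ge n) => //; lia.
elim: k => [|k IHk] {u}s {}s_aut u k_u.
  have max_eq s' v : caut N s' -> last v.2 -> (s' v).2 = v.2.
    by move=> s'_aut v_max; rewrite (eqP v_max); apply/eqP; apply: caut_max.
  have [/(max_eq s)->//|u_nmax] := boolP (last u.2).
  have [su_max|su_nmax] := boolP (last (s u).2).
    by rewrite -{2}(permK s u) (max_eq s^-1) //; apply: cautV.
  have u_end : near_end u.2.
    apply/orP; right; apply/eqP/val_inj.
    rewrite -[LHS]/(nat_of_ord (S u.2)) val_ordS //=.
    by have := ltn_ord u.2; have := u_nmax; rewrite -val_eqE /=; lia.
  apply: (@ordS_inj n.+1); have := caut_near_end s_aut u; rewrite u_end.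
  move: u_end; rewrite /near_end (negPf u_nmax) (negPf su_nmax).
  by move=> /eqP-> /eqP->.
have [/IHk->//|u_lt] := leqP (n - k.+1) u.2.
have [su_ge|su_lt] := leqP (n - k.+1) (s u).2.
  by rewrite -{2}(permK s u) (IHk s^-1) //; apply: cautV.
have nmax (i : 'I_n.+1) : i < n -> ~~ last i.
  by rewrite -val_eqE ltn_neqAle => /andP[].
have vS (i : 'I_n.+1) : i < n -> S i = i.+1 :> nat by move/nmax/val_ordS.
have u_n : u.2.+1 < n by lia.
have su_n : (s u).2 < n by lia.
case Es: (s u) su_n su_lt => [g i] /= su_n su_lt.
have: carc N (s u) (s (s^-1 (g, S i))).
  by rewrite permKV Es /carc /= mulgV -e0 memN mem_ab eqxx orbT.
rewrite s_aut; case: u k_u u_lt u_n {Es} => g' j /= k_u u_lt u_n.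
case/carcP=> -[t l] /=; rewrite memN => Nt ev.
have l_j : (l == S (S j)) || (l == S j).
  by case/orP: Nt => /andP[->]; rewrite ?orbT.
have Sj := vS j (ltnW u_n); have SSj : S (S j) = j.+2 :> nat by rewrite vS Sj.
have l_ge : n - k.+1 <= l by case/orP: l_j => /eqP->; rewrite ?SSj ?Sj; lia.
have := IHk s s_aut (t * g', l) l_ge; rewrite -{1}ev permKV /=.
move/(congr1 (@nat_of_ord _)); rewrite vS // => e_il.
(* The out-neighbour of [s u] in layer [i + 1] comes from a preserved layer [j + 1] or [j + 2]; the
   second would put [s u] in layer [j + 1], which is already known to be too high. *)
by apply: val_inj => /=; case/orP: l_j e_il => /eqP->; rewrite ?SSj ?Sj; lia.
Qed.

(* The fixed sets F i of the layers all have the same size, since left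
   multiplication by c i maps F i into F (i + 2), and F i also maps into
   F (i + 1) for the last two layers; so these inclusions are equalities. *)
Let rigid s : caut N s -> s (1, ord_max) = (1, ord_max) -> forall u, s u = u.
Proof.
move=> s_aut s1; have s_lay := layers s_aut.
pose F i := [set g | s (g, i) == (g, i)].
have memF g i : reflect (s (g, i) = (g, i)) (g \in F i).
  by rewrite inE; apply: eqP.
have leF t i j : (forall g, g \in F i -> t * g \in F j) -> #|F i| <= #|F j|.
  move=> tF; rewrite -(card_lcoset _ t); apply/subset_leq_card/subsetP=> g.
  by case/lcosetP=> g' /tF + ->.
have Fc g i : g \in F i -> c i * g \in F (S (S i)).
  by move/memF=> sg; apply/memF; apply: (fix_c fh s_aut s_lay sg).
(* The unique inner arc ends at the fixed vertex [(c i * g, S (S i))], so its source is fixed as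
   well. *)
have Fd g i : near_end i -> g \in F i -> e false (last i) * g \in F (S i).
  move=> i_end Fg; apply/memF; move/memF: (Fc _ _ Fg) => sc.
  have d_ab : e false (last i) \in [:: a i; b i].
    by rewrite mem_ab; case: (last i).
  have [t t_in et] := fix_ab fh s_aut s_lay (elimT (memF _ _) Fg) d_ab.
  rewrite et; congr (_ * _, _).
  have arc_c : carc N (s (e false (last i) * g, S i)) (s (c i * g, S (S i))).
    rewrite s_aut carcM /carc /= e_div memN eqxx mem_ab.
    move: i_end (@last_S i); rewrite /near_end i_S.
    by case: (last i); case: (last (S i)) => //= _ /(_ isT).
  move: arc_c; rewrite et sc carcM => arc_c.
  by have [||[->]] := unique_arc i_end _ _ arc_c;
    rewrite // memN ?eqxx ?t_in ?orbT.
have Fab g i t : near_end i -> t \in [:: a i; b i] ->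
    g \in F i -> t * g \in F (S i).
  move=> i_end t_in Fg; have Fdg := Fd _ _ i_end Fg.
  have [->//|t_d] := eqVneq t (e false (last i)).
  have [t' t'_in et] := fix_ab fh s_aut s_lay (elimT (memF _ _) Fg) t_in.
  have t'_d : t' != e false (last i).
    apply: contraNneq t_d => t'_d; rewrite t'_d -(elimT (memF _ _) Fdg) in et.
    by case: (perm_inj et) => /mulIg->.
  apply/memF; rewrite et; congr (_ * _, _); move: t_in t'_in t_d t'_d.
  rewrite !inE => /pred2P[]-> /pred2P[]-> //; rewrite /a /b !e_eq;
    by case: (last i).
(* Double steps from layer [i] reach one of the last two layers, and [Fd] makes the remaining single
   step. *)
have leF_max i : #|F i| <= #|F ord_max|.
  have [m] := ubnP (n - i); elim: m i => // m IHm i le_m.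
  have [/eqP->//|ni] := boolP (last i).
  have [Si|nSi] := boolP (last (S i)).
    rewrite -(eqP Si); apply: (leF (e false (last i))) => g; apply: Fd.
    by rewrite /near_end Si orbT.
  apply: (leq_trans (leF _ _ _ (Fc ^~ i))); apply: IHm.
  rewrite val_ordS // val_ordS //.
  by have := ltn_ord (S i); rewrite val_ordS //; lia.
(* From the last layer, [Fd] reaches layer 0 and [c] reaches layer 1; double steps do the rest. *)
have leF_min i : #|F ord_max| <= #|F i|.
  have S_max : S ord_max = ord0 by apply: ordS_max.
  case: i => m; elim/ltn_ind: m => -[|[|m]] IHm lt_m.
  - apply: (leF (e false true)) => g Fg; rewrite (_ : Ordinal _ = S ord_max).
      by have := Fd g ord_max; rewrite eqxx; apply.
    by rewrite S_max; apply: val_inj.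
  - apply: (leF (c ord_max)) => g Fg; rewrite (_ : Ordinal _ = S (S ord_max)).
      exact: Fc.
    by rewrite S_max; apply: val_inj; rewrite /= modn_small // ltnW.
  have lt_m' : m < n.+1 by lia.
  apply: leq_trans (IHm m _ lt_m') _; first by lia.
  apply: (leF (c (Ordinal lt_m'))) => g Fg.
  rewrite (_ : Ordinal lt_m = S (S (Ordinal lt_m'))); first exact: Fc.
  by apply: val_inj; rewrite /= !modn_small //; lia.
have eF i : #|F i| = #|F ord_max| by apply/eqP; rewrite eqn_leq leF_max leF_min.
have F_max : F ord_max = [set: gT].
  have sub_max i j : (forall g, g \in F i -> g \in F j) -> F i = F j.
    by move=> sF; apply/eqP; rewrite eqEcard !eF leqnn andbT; apply/subsetP.
  apply: (left_closed_setT gen_xy) => [|g|g]; first exact/memF.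
    (* The label [1] identifies the fixed sets of consecutive layers at the end: [x] is then
       supplied by [b] in the layer before the last, and [y] by [b] in the last layer. *)
    pose p : 'I_n.+1 := ord_pred ord_max.
    have Sp : S p = ord_max by apply: ord_predK.
    have p_end : near_end p by rewrite /near_end Sp eqxx orbT.
    have np : last p = false.
      by apply/negP => /last_S; rewrite Sp eqxx.
    have Fp : F p = F ord_max.
      apply: sub_max => g' Fg'; have := Fab g' p 1 p_end _ Fg'.
      by rewrite Sp mul1g; apply; rewrite -e0 mem_ab.
    have := Fab g p x p_end; rewrite Fp Sp; apply.
    by rewrite !inE /b np /e expg0 mulg1 expg1 eqxx orbT.
  have F0 : F ord_max = F (S ord_max).
    apply: sub_max => g' Fg'; have := Fab g' ord_max 1 near_end_max _ Fg'.
    by rewrite mul1g; apply; rewrite -e0 mem_ab.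
  move=> Fg; rewrite F0; apply: Fab => //.
  by rewrite !inE /b eqxx /e expg0 mul1g expg1 eqxx orbT.
case=> g i; apply/memF; suff -> : F i = [set: gT] by rewrite inE.
by apply/eqP; rewrite eqEcard subsetT eF F_max leqnn.
Qed.

Lemma OmSR_Klein_cycle : admits_OmSR [set: gT] n.+1 3.
Proof.
rewrite -[n.+1]card_ord.
apply: (@mCayley_OmSR _ _ _ _ _ _ _ _ _ fh ab asym ord_max _ rigid).
- exact: inj_comp (@ordS_inj _) (@ordS_inj _).
- exact: ordS_inj.
- by move=> s /layers->.
Qed.

End KleinCycle.

Lemma abelem_Z2_Z2 : 2.-abelem [set: 'Z_2 * 'Z_2].
Proof.
apply/abelemP => //; split.
  by apply/centsP=> -[a b] _ [a' b'] _; congr (_, _); apply: Zp_mulgC.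
case=> a b _; case: a b => -[|[|//]] ? [[|[|//]] ?];
  by congr (_, _); apply: val_inj.
Qed.

Lemma card_Z2_Z2 : #|[set: 'Z_2 * 'Z_2]| = 4.
Proof. by rewrite cardsT card_prod !card_ord. Qed.

(** * Two-generated groups *)

Section TwoGenerated.

Variables (gT : finGroupType) (m : nat).
Hypotheses (ncycT : ~~ cyclic [set: gT]) (m_ge2 : 1 < m).

Lemma gen_notin (x y : gT) : <<[set x; y]>> = [set: gT] -> y \notin <[x]>.
Proof.
move=> gen_xy; apply: contra ncycT => xy; apply/cyclicP; exists x.
apply/eqP; rewrite eqEsubset subsetT -gen_xy gen_subG subUset !sub1set.
by rewrite cycle_id xy.
Qed.

Lemma gen_mul (x y : gT) :
  <<[set x; y]>> = [set: gT] -> <<[set x * y; y]>> = [set: gT].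
Proof.
move=> gen_xy; apply/eqP; rewrite eqEsubset subsetT -gen_xy gen_subG.
rewrite subUset !sub1set.
have y_in : y \in <<[set x * y; y]>> by rewrite mem_gen // !inE eqxx orbT.
by rewrite y_in -(groupMr x y_in) mem_gen // !inE eqxx.
Qed.

Lemma OmSR_generator (x y : gT) :
  <<[set x; y]>> = [set: gT] -> x ^+ 2 != 1 -> admits_OmSR [set: gT] m 3.
Proof.
have long (u v : gT) : <<[set u; v]>> = [set: gT] -> u ^+ 2 != 1 ->
    (2 < m) || (u ^+ 3 != 1) -> admits_OmSR [set: gT] m 3.
  case: m m_ge2 => // n n_gt0 gen_uv u2 mu.
  by apply: (OmSR_long_cycle n_gt0 gen_uv) => //; apply: gen_notin.
move=> gen_xy x2; have [m_gt2|m_le2] := ltnP 2 m.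
  by apply: (long x y); rewrite ?m_gt2.
have m2 : m = 2 by apply/eqP; rewrite eqn_leq m_le2.
have [x3|x3] := eqVneq (x ^+ 3) 1; last first.
  by apply: (long x y); rewrite // x3 orbT.
have y_notin := gen_notin gen_xy.
have [xyC|] := eqVneq (x * y) (y * x); last first.
  by rewrite m2; apply: (OmSR2_noncommuting gen_xy).
have [y3|y3] := eqVneq (y ^+ 3) 1.
  by rewrite m2; apply: (OmSR2_order3 gen_xy).
have [y2|y2] := eqVneq (y ^+ 2) 1; last first.
  by apply: (long y x); rewrite ?y2 ?y3 ?orbT // setUC.
(* Here [x * y] has square [x ^+ 2] and cube [y ^+ 3], both nontrivial. *)
apply: (long (x * y) y); rewrite ?gen_mul // expgMn // ?y2 ?mulg1 //.
by rewrite x3 mul1g y3 orbT.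
Qed.

(** [x * y] equals its inverse [y^-1 * x^-1], which is [y * x]. *)
Lemma mul_involutions_commute (x y : gT) :
  x ^+ 2 = 1 -> y ^+ 2 = 1 -> (x * y) ^+ 2 = 1 -> commute x y.
Proof.
move=> x2 y2 xy2; rewrite /commute.
have inv_of (z : gT) : z ^+ 2 = 1 -> z^-1 = z.
  by move=> z2; apply: (mulgI z); rewrite mulgV -[z * z](expgS z 1).
by rewrite -(inv_of (x * y)) // invMg !inv_of.
Qed.

Lemma Klein_isog (x y : gT) : <<[set x; y]>> = [set: gT] ->
  x ^+ 2 = 1 -> y ^+ 2 = 1 -> commute x y -> [set: gT] \isog [set: 'Z_2 * 'Z_2].
Proof.
move=> gen_xy x2 y2 xyC.
have cxy : <[x]> \subset 'C(<[y]>) by apply: cents_cycle.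
have defT : [set: gT] = <[x]> * <[y]>.
  by rewrite -cent_joinEl // joing_idl joing_idr.
have abT : 2.-abelem [set: gT].
  rewrite abelemE //; apply/andP; split.
    by rewrite -[X in abelian X]/[set: gT] defT abelianM !cycle_abelian centsC.
  apply/exponentP => z _; have : z \in <[x]> * <[y]> by rewrite -defT inE.
  case/mulsgP=> _ _ /cycleP[i ->] /cycleP[j ->] ->.
  rewrite expgMn; last exact: commuteX2.
  by rewrite !(expgAC _ _ 2) x2 y2 !expg1n mulg1.
(* The product of two cycles of order at most 2 has at most four elements, and a non-cyclic
   elementary abelian 2-group has at least four. *)
have cardT : #|[set: gT]| = 4.
  apply/eqP; rewrite eqn_leq; apply/andP; split.
    rewrite defT (leq_trans (leq_pmulr _ (cardG_gt0 (<[x]> :&: <[y]>)))) //.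
    rewrite -mul_cardG; apply: (@leq_mul _ _ 2 2); apply: dvdn_leq => //.
      by rewrite order_dvdn x2.
    by rewrite order_dvdn y2.
  have := ncycT; rewrite (abelem_cyclic abT) -ltnNge => lg.
  by rewrite (card_pgroup (abelem_pgroup abT)); apply: (@leq_pexp2l 2 2).
by rewrite (isog_abelem_card _ abT) cardT card_Z2_Z2 eqxx abelem_Z2_Z2.
Qed.

Lemma OmSR_two_generated (x y : gT) : <<[set x; y]>> = [set: gT] ->
    ~ ([set: gT] \isog [set: 'Z_2 * 'Z_2] /\ m = 2) ->
  admits_OmSR [set: gT] m 3.
Proof.
move=> gen_xy not_Klein.
have [x2|] := eqVneq (x ^+ 2) 1; last exact: OmSR_generator gen_xy.
have gen_yx : <<[set y; x]>> = [set: gT] by rewrite setUC.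
have [y2|] := eqVneq (y ^+ 2) 1; last exact: OmSR_generator gen_yx.
have [xy2|] := eqVneq ((x * y) ^+ 2) 1; last first.
  exact: OmSR_generator (gen_mul gen_xy).
have xyC := mul_involutions_commute x2 y2 xy2.
have m_gt2 : 2 < m.
  rewrite ltn_neqAle m_ge2 andbT; apply/eqP => m2; apply: not_Klein.
  by split; first exact: Klein_isog xyC.
have x_neq1 : x != 1.
  by apply: contraNneq (gen_notin gen_yx) => ->; apply: group1.
case: m m_gt2 => // n n_gt1.
exact: OmSR_Klein_cycle n_gt1 gen_xy x2 y2 xyC x_neq1 (gen_notin gen_xy).
Qed.

End TwoGenerated.

(** * Transport along isomorphisms and the exceptional case *)

Lemma isog_OmSR (aT rT : finGroupType) (G : {group aT}) (H : {group rT}) m k :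
  G \isog H -> admits_OmSR G m k -> admits_OmSR H m k.
Proof.
move=> isoGH [Gamma [ori reg [K [sK isoK semi orbs]] aut]].
exists Gamma; split=> //; last exact: isog_trans isoGH.
by exists K; split=> //; apply: isog_trans isoGH.
Qed.

(** Two regular orbits give eight vertices. No arc joins two vertices of one orbit, so the three
    out-neighbours and three in-neighbours of a vertex would be six distinct vertices among the four
    of the other orbit. *)
Lemma Klein_not_OmSR2 (gT : finGroupType) (G : {group gT}) :
  2.-abelem G -> #|G| = 4 -> ~ admits_OmSR G 2 3.
Proof.
move=> abG oG [Gamma [[ori noloop] reg [H [/subsetP autH isoHG semi orbs]] _]].
have oH : #|H| = 4 by rewrite (card_isog isoHG).
have abH : 2.-abelem H by rewrite (isog_abelem isoHG).
have card_orb v : #|orbit 'P H v| = 4.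
  by rewrite card_orbit semi indexg1.
have /card_gt0P[u _] := vertex_nonempty Gamma.
have card_V : #|Gamma| = 8.
  have acts : [acts H, on [set: Gamma] | 'P].
    by apply/actsP=> h _ v; rewrite !inE.
  rewrite -cardsT (card_uniform_partition _ (orbit_partition acts) (n := 4)).
    by rewrite orbs.
  by move=> _ /imsetP[v _ ->].
have hK h v : h \in H -> h (h v) = v.
  have /abelemP[//|_ H2] := abH.
  by move/H2/permP/(_ v); rewrite perm1 expgS expg1 permM.
(* The involution [h] exchanges [v] and [h v], so it would reverse the arc. *)
have swap h v : h \in H -> Defs.arc v (h v) -> False.
  move=> Hh vhv; have /digraph_autP/(_ v (h v)) := autH h Hh.
  rewrite hK // vhv => /esym hvv; have [e|ne] := eqVneq v (h v).
    by apply: (noloop v); rewrite {2}e.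
  by apply: (ori _ _ ne).
pose outs := [set v | Defs.arc u v]; pose ins := [set v | Defs.arc v u].
have [/= o_out o_in] := reg u.
have dis : [disjoint outs & ins].
  apply/pred0P=> v; apply/negbTE/negP; rewrite !inE => /andP[uv vu].
  have [e|ne] := eqVneq u v; last exact: (ori u v).
  by apply: (noloop u); rewrite {2}e.
have sub : outs :|: ins \subset ~: orbit 'P H u.
  apply/subsetP=> v; rewrite !inE => arcs; apply/orbitP=> -[h Hh /= ehv].
  rewrite -{}ehv /aperm in arcs; case/orP: arcs; first exact: swap.
  by rewrite -{2}(hK h u Hh); apply: swap.
have := subset_leq_card sub; rewrite cardsU (disjoint_setI0 dis) cards0 subn0.
rewrite [#|outs|]o_out [#|ins|]o_in.
by have := cardsC (orbit 'P H u); rewrite card_V card_orb => /addnI ->.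
Qed.

Theorem theorem1p2 (gT : finGroupType) (G : {group gT}) (x y : gT) (m : nat)
    (genG : G :=: <<[set x; y]>>) (ncycG : ~~ cyclic G) (m_ge2 : (2 <= m)%N) :
  admits_OmSR G m 3 <-> ~ (G \isog [set: 'Z_2 * 'Z_2] /\ m = 2).
Proof.
split=> [adm [isoG m2] | not_Klein].
  rewrite m2 in adm; apply: Klein_not_OmSR2 adm.
    by rewrite (isog_abelem isoG) abelem_Z2_Z2.
  by rewrite (card_isog isoG) card_Z2_Z2.
(* The construction uses all elements of a group type, so [G] is replaced by [subg_of G]. *)
have isoG := isog_subg G.
apply: (isog_OmSR (G := [set: subg_of G]%G)); first by rewrite isog_sym.
apply: (@OmSR_two_generated _ _ _ _ (subg G x) (subg G y)) => //.
- by rewrite -(isog_cyclic isoG).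
- have sG : [set x; y] \subset G by rewrite genG subset_gen.
  have [Gx Gy] : x \in G /\ y \in G.
    by split; apply: (subsetP sG); rewrite !inE eqxx ?orbT.
  transitivity (subg G @* <<[set x; y]>>); last by rewrite -genG im_subg.
  by rewrite morphim_gen // morphimU !morphim_set1.
by case=> isoT m2; apply: not_Klein; split=> //; apply: isog_trans isoT.
Qed.
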